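(* Let $b=b_1\otimes\cdots\otimes b_L\in B_{\lambda_1}\otimes\cdots\otimes B_{\lambda_L}$ be an arbitrary path (highest weight or not), and set $N=E_1(b)$. Consider the following procedure. Step 1. Draw the table (the local energy distribution) with entry $E_{l,j}-E_{l-1,j}\in\{0,1\}$ in the $l$-th row and $j$-th column ($l\ge1$, $1\le j\le L$). Step 2. Starting from the rightmost $1$ in the row $l=1$, pick one $1$ from each successive row, where the one picked in row $l+1$ must be weakly right of the one picked in row $l$. If there is no such $1$ in row $l+1$, stop; the position of the last picked $1$ is called $(\mu_1,j_1)$ (row index, column index). Change all picked $1$'s into $0$. Step 3. Repeat Step 2 on the current table $N-1$ more times to determine $(\mu_2,j_2),\ldots,(\mu_N,j_N)$, thereby making all $1$'s into $0$. Step 4. Put $r_k=\sum_{i=1}^{j_k-1}\min(\mu_k,\lambda_i)+E_{\mu_k,j_k}-2\sum_{i=1}^{j_k}E_{\mu_k,i}$ for $k=1,\dots,N$. In this procedure, which computes $(\lambda,(\mu,r))=\phi(b)$, Step 2 can be replaced by the following Step $2'$: Step $2'$. Pick one of the lowest $1$'s of the table (those with the largest row index) arbitrarily, and denote its position by $(\mu_1,j_1)$. Starting from $(\mu_1,j_1)$, choose one $1$ from each row successively (going upward to the first row) as follows: if the $1$ at $(l,k_l)$ has been chosen, then the next chosen position $(l-1,k_{l-1})$ is that of the rightmost $1$ among the entries at $(l-1,1),(l-1,2),\ldots,(l-1,k_l)$. Change all chosen $1$'s into $0$. The resulting groups (the sets of positions of $1$'s selected in each single execution of the step) are the same as those obtained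 with Step 2, up to reordering in subscripts.
   Context: Crystals. For an integer $k\ge 1$, $B_k=\{(x_1,x_2)\in\mathbb{Z}_{\ge 0}^2 : x_1+x_2=k\}$; the element $(x_1,x_2)$ is identified with the one-row semistandard tableau containing $x_1$ letters $1$ and $x_2$ letters $2$. Put $u_l=(l,0)\in B_l$. A path is an element $b=b_1\otimes\cdots\otimes b_L\in B_{\lambda_1}\otimes\cdots\otimes B_{\lambda_L}$ (a sequence $(b_1,\dots,b_L)$ with $b_i\in B_{\lambda_i}$). Combinatorial $R$ and energy function. For $x=(x_1,x_2)\in B_k$ and $y=(y_1,y_2)\in B_l$, the combinatorial $R$ is the map $B_k\otimes B_l\to B_l\otimes B_k$, $x\otimes y\simeq\tilde y\otimes\tilde x$, with $\tilde x_i=x_i+Q_i-Q_{i-1}$, $\tilde y_i=y_i+Q_{i-1}-Q_i$, where $Q_i=\min(x_{i+1},y_i)$ and indices are mod $2$ (so $Q_0=Q_2=\min(x_1,y_2)$, $Q_1=\min(x_2,y_1)$). The energy function is $H(x\otimes y)=Q_0=\min(x_1,y_2)$. Local energies. For a path $b$ and $l\ge 1$, put $u_l^{(0)}=u_l$ and define $u_l^{(j)}\in B_l$ and $b_j'\in B_{\lambda_j}$ recursively by $u_l^{(j-1)}\otimes b_j\simeq b_j'\otimes u_l^{(j)}$. Set $E_{l,j}=H(u_l^{(j-1)}\otimes b_j)$, $E_{0,j}=0$, and $E_l=E_l(b)=\sum_{j=1}^L E_{l,j}$. The map $\phi$ (Kerov--Kirillov--Reshetikhin map). $\phi(b)=(\lambda,(\mu,r))$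 consists of a sequence of rows $\lambda$ (the quantum space) and a finite multiset of pairs $(\mu_j,r_j)$ (a row of length $\mu_j\ge1$ of the configuration $\mu$ with its rigging $r_j\in\mathbb{Z}$); the ordering of the pairs is irrelevant. Given $\lambda,\mu$, set $Q_j^{(0)}=\sum_k\min(j,\lambda_k)$, $Q_j^{(1)}=\sum_k\min(j,\mu_k)$; the vacancy number is $p_j=Q_j^{(0)}-2Q_j^{(1)}$, and a row $\mu_i$ is singular if $r_i=p_{\mu_i}$. One starts with $\lambda=\mu=\emptyset$ and processes $b_1,b_2,\dots,b_L$ in this order; within $b_i$ one processes first all letters $2$ and then all letters $1$, one letter at a time. Each letter of $b_i$ adds one box to the $i$-th row of $\lambda$ (which has length $0$ before its first letter). A letter $1$ does nothing else: $\mu$ and all riggings are unchanged. For a letter $2$, in addition, one box is added to the longest row of $\mu$ that is singular with respect to the vacancy numbers before this letter is processed (if there is no singular row, a new row of length $1$ is created in $\mu$); the rigging of the row that was lengthened or created is then set equal to its vacancy number computed from the new $\lambda$ and $\mu$, and all other riggings are unchanged. *)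

(* Defs.v *)
From mathcomp Require Import all_boot all_order all_algebra.
From mathcomp Require Import finmap.

Set Implicit Arguments.
Unset Strict Implicit.
Unset Printing Implicit Defensive.

Import GRing.Theory.

(** * Crystals *)

Definition elt := (nat * nat)%type.

Definition inB (k : nat) (x : elt) : bool := x.1 + x.2 == k.

Definition is_path (lam : seq nat) (b : seq elt) : bool :=
  all (leq 1) lam && all2 inB lam b.

Definition Q0 (x y : elt) : nat := minn x.1 y.2.
Definition Q1 (x y : elt) : nat := minn x.2 y.1.

(* [combR x y = (y~, x~)] when x (x) y ~ y~ (x) x~.  The subtractions never
   truncate: Q0 <= x.1, y.2 and Q1 <= x.2, y.1. *)
Definition combR (x y : elt) : elt * elt :=
  ((y.1 + Q0 x y - Q1 x y, y.2 + Q1 x y - Q0 x y),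
   (x.1 + Q1 x y - Q0 x y, x.2 + Q0 x y - Q1 x y)).

Definition energyH (x y : elt) : nat := Q0 x y.

(** * Local energies *)

(* Tensor factors and columns are numbered from 1: the j-th factor of b is
   [nth (0, 0) b j.-1]. *)
Fixpoint carrier (b : seq elt) (l j : nat) : elt :=
  if j is j'.+1 then (combR (carrier b l j') (nth (0, 0) b j')).2 else (l, 0).

(* Columns outside 1, ..., size b get the dummy value 0. *)
Definition locE (b : seq elt) (l j : nat) : nat :=
  if l is 0 then 0
  else if j is j'.+1 then energyH (carrier b l j') (nth (0, 0) b j') else 0.

Definition totE (b : seq elt) (l : nat) : nat :=
  \sum_(1 <= j < (size b).+1) locE b l j.

(** * The Kerov-Kirillov-Reshetikhin map *)

(* (length, rigging) of a row of the configuration *)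
Definition rrow := (nat * int)%type.

Definition vacancy (lam mu : seq nat) (j : nat) : int :=
  ((\sum_(k <- lam) minn j k)%N%:Z - 2 * (\sum_(k <- mu) minn j k)%N%:Z)%R.

Definition singular (lam : seq nat) (rc : seq rrow) (x : rrow) : bool :=
  x.2 == vacancy lam (map fst rc) x.1.

Definition longest_singular (lam : seq nat) (rc : seq rrow) (x : rrow) : bool :=
  singular lam rc x &&
  all (fun y => singular lam rc y ==> (y.1 <= x.1)) rc.

Definition kkr_state := (seq nat * seq rrow)%type.

(* [incr_nth] pads with zeros, so it also creates the i-th row if needed. *)
Definition add_letter1 (i : nat) (st : kkr_state) : kkr_state :=
  (incr_nth st.1 i, st.2).

(* Longest singular rows of equal length also have equal riggings, so that taking
   the first of them does not affect the resulting multiset.  If there is no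
   singular row then [find] returns [size rc] and a new row of length 1 is
   appended. *)
Definition add_letter2 (i : nat) (st : kkr_state) : kkr_state :=
  let: (lam, rc) := st in
  let a := find (longest_singular lam rc) rc in
  let lam' := incr_nth lam i in
  let mu' := incr_nth (map fst rc) a in
  let m := nth 0 mu' a in
  (lam', set_nth (0, 0%R) rc a (m, vacancy lam' mu' m)).

Definition add_elt (i : nat) (x : elt) (st : kkr_state) : kkr_state :=
  iter x.1 (add_letter1 i) (iter x.2 (add_letter2 i) st).

Definition phi (b : seq elt) : kkr_state :=
  foldl (fun st i => add_elt i (nth (0, 0) b i) st) ([::], [::])
        (iota 0 (size b)).

(* The list of riggings of the rows is to be read up to order. *)
Definition phi_is (b : seq elt) (lam : seq nat) (rc : seq rrow) : Prop :=
  (phi b).1 = lam /\ perm_eq (phi b).2 rc.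

(** * Tables and the selection procedures *)

(* (row, column), both numbered from 1 *)
Definition pos := (nat * nat)%type.

Definition table := pos -> int.

(* The local energy distribution, extended by 0 outside the actual table. *)
Definition energy_table (b : seq elt) : table := fun p =>
  if (0 < p.1) && (0 < p.2 <= size b)
  then ((locE b p.1 p.2)%:Z - (locE b p.1.-1 p.2)%:Z)%R else 0%R.

Definition one (T : table) (p : pos) : bool := T p == 1%R.

Definition clear (T : table) (g : seq pos) : table :=
  fun p => if p \in g then 0%R else T p.

(* One execution of a step on T selects a group g of positions, and an endpoint e
   in g, the position called (mu_k, j_k). *)
Definition step := table -> seq pos -> pos -> Prop.

Definition down_right : rel pos :=
  fun p q => (q.1 == p.1.+1) && (p.2 <= q.2).

(* Any weakly right 1 of the next row may be picked. *)
Definition step2 : step := fun T g e =>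
  exists (k : nat) (s : seq pos),
    [/\ g = (1, k) :: s /\ e = last (1, k) s,
        all (one T) g,
        forall j, one T (1, j) -> j <= k,
        path down_right (1, k) s
      & forall j, one T (e.1.+1, j) -> ~~ (e.2 <= j)].

(* [climb T p s]: s lists the positions chosen after p = (l, k), going up to the
   first row. *)
Inductive climb (T : table) : pos -> seq pos -> Prop :=
| climb_top k : climb T (1, k) [::]
| climb_up l k k' s :
    one T (l.+1, k') -> k' <= k ->
    (forall j, one T (l.+1, j) -> j <= k -> j <= k') ->
    climb T (l.+1, k') s ->
    climb T (l.+2, k) ((l.+1, k') :: s).

Definition step2' : step := fun T g e =>
  exists s : seq pos,
    [/\ g = e :: s,
        one T e,
        forall p, one T p -> p.1 <= e.1
      & climb T e s].

(* [run st T gs T']: successive executions of st turn T into T', with groups and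
   endpoints listed in gs. *)
Inductive run (st : step) : table -> seq (seq pos * pos) -> table -> Prop :=
| run_nil T : run st T [::] T
| run_cons T g e gs T' :
    st T g e -> run st (clear T g) gs T' -> run st T ((g, e) :: gs) T'.

Definition rigging (lam : seq nat) (b : seq elt) (p : pos) : int :=
  let: (m, j) := p in
  ((\sum_(1 <= i < j) minn m (nth 0 lam i.-1))%N%:Z + (locE b m j)%:Z
   - 2 * (\sum_(1 <= i < j.+1) locE b m i)%N%:Z)%R.

Definition rigged_rows (lam : seq nat) (b : seq elt)
    (gs : seq (seq pos * pos)) : seq rrow :=
  [seq (x.2.1, rigging lam b x.2) | x <- gs].

(* The procedure built on the step st computes phi(b) in exactly N = E_1(b)
   executions: it never gets stuck before, and whatever the choices made, all 1's
   have then been changed into 0 and the outcome is phi(b). *)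
Definition computes_phi (st : step) (lam : seq nat) (b : seq elt) : Prop :=
  (forall gs T, run st (energy_table b) gs T -> size gs < totE b 1 ->
     exists g e, st T g e) /\
  (forall gs T, run st (energy_table b) gs T -> size gs = totE b 1 ->
     (forall p, T p = 0%R) /\ phi_is b lam (rigged_rows lam b gs)).

Definition groups (gs : seq (seq pos * pos)) : seq {fset pos} :=
  [seq [fset p in x.1]%fset | x <- gs].

(* Main.v *)
Require Import Defs.
From mathcomp Require Import all_boot all_order all_algebra.
From mathcomp Require Import finmap.
From mathcomp Require Import zify.

(* Write bit l of the carriers for the difference between the numbers of 2's in
   the carriers of capacities l and l-1.  A factor (y1, y2) turns the first y2
   zeros of this bit string into 1's and, simultaneously, its first y1 ones into
   0's; the table has a 1 at (l, j) exactly when the j-th factor writes bit l.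
   Link every 1 below the first row to the rightmost 1 weakly left of it in the
   previous row.  When bit l is written while it is the first zero, bit l-1 has
   been one since its last write, and bit l has not been written since then, as an
   erasure of bit l in between would have erased bit l-1 too.  Hence links are
   injective and the 1's split into disjoint chains starting in the first row.
   Steps 2 and 2' both remove exactly one chain.

   The Kerov-Kirillov-Reshetikhin map builds the same chains letter by letter.
   A letter 2 writes the first zero bit l.  The vacancy number p_m plus the number
   of ones among the bits 1, ..., m never decreases: each factor adds a slack to
   it.  A row of length m is created when these bits are all one, so it is singular
   exactly when they are all one and no slack was added since.  Hence singular
   rows have length < l, and the chain ending at the last write of bit l-1 is
   singular. *)

Set Implicit Arguments.
Unset Strict Implicit.
Unset Printing Implicit Defensive.

(** * Chains of linked positions *)

Definition link (O : pred pos) : rel pos := fun p q =>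
  [&& q.1 == p.1.+1, p.2 <= q.2
    & all (fun j => ~~ O (p.1, j)) (iota p.2.+1 (q.2 - p.2))].

Definition chain (O : pred pos) (c : seq pos) : bool :=
  if c is p :: s then (p.1 == 1) && path (link O) p s else false.

(** Links are taken relative to the positions of all chains of [C], so whether a list is a chain
    depends on the whole family. *)
Definition chains (C : seq (seq pos)) : bool :=
  uniq (flatten C) && all (chain [in flatten C]) C.

Lemma linkP (O : pred pos) (p q : pos) :
  reflect [/\ q.1 = p.1.+1, p.2 <= q.2 & forall j, p.2 < j <= q.2 -> ~~ O (p.1, j)]
          (link O p q).
Proof.
apply: (iffP and3P) => -[].
  move=> /eqP e le /allP h; split=> // j hj; apply: h; rewrite mem_iota; lia.
move=> -> le h; split=> //; apply/allP => j; rewrite mem_iota => hj; apply: h; lia.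
Qed.

Lemma sub_link (O O' : pred pos) (p q : pos) :
  (forall j, p.2 < j <= q.2 -> O' (p.1, j) -> O (p.1, j)) ->
  link O p q -> link O' p q.
Proof.
move=> sO /linkP[e le h]; apply/linkP; split=> // j hj.
exact: contra (sO j hj) (h j hj).
Qed.

(** The source of a link to [q], when it belongs to [O], is the rightmost member of [O] weakly left
    of [q] in the previous row. *)
Lemma link_inj (O : pred pos) (p p' q : pos) :
  O p -> O p' -> link O p q -> link O p' q -> p = p'.
Proof.
case: p p' => [l k] [l' k'] Op Op' /linkP[/= e le h] /linkP[/= e' le' h'].
have El : l' = l by lia.
subst l'; congr (_, _); apply/eqP; rewrite eqn_leq; apply/andP; split.
  by case: leqP => // lt; have := h' k; rewrite lt le Op => /(_ isT).
by case: leqP => // lt; have := h k'; rewrite lt le' Op' => /(_ isT).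
Qed.

Lemma uniq_flatten_inj (T : eqType) (C : seq (seq T)) (c c' : seq T) (x : T) :
  uniq (flatten C) -> c \in C -> c' \in C -> x \in c -> x \in c' -> c = c'.
Proof.
elim: C => //= a C IH; rewrite cat_uniq => /and3P[_ /hasPn disj U].
have no_x d : d \in C -> x \in d -> x \notin a.
  by move=> dC xd; apply: disj; apply/flattenP; exists d.
rewrite !inE => /predU1P[->|cC] /predU1P[->|cC'] // xc xc'.
- by have := no_x _ cC' xc'; rewrite xc.
- by have := no_x _ cC xc; rewrite xc'.
exact: IH.
Qed.

Lemma uniq_cat_cons_inj (T : eqType) (s1 s2 t1 t2 : seq T) (x : T) :
  uniq (s1 ++ x :: s2) -> s1 ++ x :: s2 = t1 ++ x :: t2 -> s1 = t1 /\ s2 = t2.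
Proof.
elim: s1 t1 => [|a s1 IH] [|a' t1] /=.
- by move=> _ [].
- by move=> /andP[xs _] [_ e]; rewrite e mem_cat inE eqxx orbT in xs.
- by move=> /andP[xs _] [e _]; rewrite e mem_cat inE eqxx orbT in xs.
by move=> /andP[_ U] [-> e]; have [-> ->] := IH _ U e.
Qed.

Section Chains.
Variable C : seq (seq pos).
Hypothesis chC : chains C.
Let O := [in flatten C].

Let uC : uniq (flatten C). Proof. by case/andP: chC. Qed.

Lemma mem_chain c p : c \in C -> p \in c -> p \in flatten C.
Proof. by move=> cC pc; apply/flattenP; exists c. Qed.

Lemma uniq_chain c : c \in C -> uniq c.
Proof.
move=> cC; move: uC; rewrite (perm_uniq (perm_flatten (perm_to_rem cC))) /=.
by rewrite cat_uniq => /and3P[].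
Qed.

Lemma chain_link s1 p q s2 : s1 ++ p :: q :: s2 \in C -> link O p q.
Proof.
case/andP: chC => _ /allP h /h; case: s1 => [|a s1] /=.
  by case/and3P.
by rewrite cat_path /= => /and5P[].
Qed.

Lemma chain_row s1 p s2 : s1 ++ p :: s2 \in C -> p.1 = (size s1).+1.
Proof.
elim/last_ind: s1 p s2 => [|s1 q IH] p s2.
  by case/andP: chC => _ /allP h /h /andP[/eqP].
rewrite cat_rcons => cC; have /linkP[-> _ _] := chain_link cC.
by rewrite (IH _ _ cC) size_rcons.
Qed.

Lemma chain_of p : p \in flatten C -> exists s1 s2, s1 ++ p :: s2 \in C.
Proof.
by case/flattenP=> c cC /splitPr pc; case: pc cC => s1 s2; exists s1, s2.
Qed.

Lemma parent q : q \in flatten C -> 1 < q.1 ->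
  exists s1 p s2, s1 ++ p :: q :: s2 \in C.
Proof.
move=> /chain_of[s1 [s2]]; case/lastP: s1 => [|s1 p] qC; rewrite (chain_row qC) //.
by exists s1, p, s2; rewrite -cat_rcons.
Qed.

(** The predecessor of [q] in its own chain is also linked to [q], hence equals [p] by [link_inj];
    disjointness then identifies the two chains. *)
Lemma child_next s1 p s2 q : s1 ++ p :: s2 \in C -> q \in flatten C ->
  link O p q -> exists s, s2 = q :: s.
Proof.
move=> pC qC lpq.
have pO : p \in flatten C by apply: (mem_chain pC); rewrite mem_cat inE eqxx orbT.
have q2 : 1 < q.1 by case/linkP: lpq => -> _ _; rewrite (chain_row pC).
have [t1 [p' [t2 qC']]] := parent qC q2.
have p'O : p' \in flatten C by apply: (mem_chain qC'); rewrite mem_cat inE eqxx orbT.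
have e := link_inj pO p'O lpq (chain_link qC'); subst p'.
have ec : s1 ++ p :: s2 = t1 ++ p :: q :: t2.
  by apply: (uniq_flatten_inj uC pC qC' (x := p)); rewrite mem_cat inE eqxx orbT.
by have [_ ->] := uniq_cat_cons_inj (uniq_chain pC) ec; exists t2.
Qed.

Definition rightmost (p : pos) := forall j, O (p.1, j) -> j <= p.2.

Lemma rightmost_link p q :
  rightmost p -> q.1 = p.1.+1 -> p.2 <= q.2 -> link O p q.
Proof.
move=> rp e le; apply/linkP; split=> // j /andP[lt _].
by apply/negP=> /rp; lia.
Qed.

(** A member further right than [q] in its row would be linked to [p] as well, but the only child of
    [p] is [q]. *)
Lemma rightmost_next s1 p q s2 :
  s1 ++ p :: q :: s2 \in C -> rightmost p -> rightmost q.
Proof.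
move=> cC rp j Oj; case: leqP => // lt.
have /linkP[e le _] := chain_link cC.
have [|s [ej _]] := child_next cC Oj.
  by apply: rightmost_link => //=; lia.
by rewrite ej /= ltnn in lt.
Qed.

Lemma rightmost_last s1 p s2 :
  s1 ++ p :: s2 \in C -> rightmost p -> rightmost (last p s2).
Proof.
elim: s2 s1 p => [|q s2 IH] s1 p // cC rp /=.
apply: (IH (rcons s1 p)); first by rewrite cat_rcons.
exact: rightmost_next cC rp.
Qed.

Lemma last_childless s1 p q :
  s1 ++ [:: p] \in C -> q \in flatten C -> ~~ link O p q.
Proof. by move=> cC qO; apply/negP=> /(child_next cC qO)[]. Qed.

(** From a rightmost position every member weakly right in the next row is linked, so it is the next
    one in the chain. The free choice in Step 2 is thus forced. *)
Lemma greedy_descent s1 p s2 s :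
  s1 ++ p :: s2 \in C -> rightmost p -> all O s -> path down_right p s ->
  (forall j, O ((last p s).1.+1, j) -> ~~ ((last p s).2 <= j)) -> s = s2.
Proof.
elim: s s1 p s2 => [|q s IH] s1 p s2 cC rp /=.
  move=> _ _ stop; case: s2 cC => // q s2 cC.
  have /linkP[e le _] := chain_link cC.
  have := stop q.2; rewrite le -e -surjective_pairing => h.
  suff: false by []. apply: h. apply: (mem_chain cC).
  by rewrite mem_cat !inE eqxx !orbT.
move=> /andP[Oq Os] /andP[/andP[/eqP e le] ps] stop.
have [s3 es2] := child_next cC Oq (rightmost_link rp e le); subst s2.
congr (_ :: _); apply: (IH (rcons s1 p) q) => //; first by rewrite cat_rcons.
exact: rightmost_next cC rp.
Qed.

End Chains.

(** A link only forbids members in between, so deleting positions preserves the remaining links. *)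
Lemma chains_rem C c : chains C -> c \in C -> chains (rem c C).
Proof.
move=> chC cC; have pC := perm_to_rem cC; have pf := perm_flatten pC.
case/andP: (chC) => U A; apply/andP; split.
  by move: U; rewrite (perm_uniq pf) /= cat_uniq => /and3P[].
apply/allP=> -[|p s] dC; have := allP A _ (mem_rem dC) => //=.
case/andP=> -> /=; apply: sub_path => q r; apply: sub_link => j _.
by rewrite /= (perm_mem pf) /= mem_cat => ->; rewrite orbT.
Qed.

Lemma mem_flatten_rem C c p : chains C -> c \in C ->
  (p \in flatten (rem c C)) = (p \in flatten C) && (p \notin c).
Proof.
move=> /andP[U _] cC; have pf := perm_flatten (perm_to_rem cC).
move: U; rewrite (perm_uniq pf) (perm_mem pf) /= cat_uniq mem_cat => /and3P[_ /hasPn h _].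
case: (boolP (p \in c)) => pc; last by rewrite andbT.
by rewrite andbF; apply/negP=> /h /=; rewrite pc.
Qed.

Section Extend.
Variables (C : seq (seq pos)) (p : pos).
Hypotheses (chC : chains C) (pC : p \notin flatten C).
Hypothesis left_p : forall q, q \in flatten C -> q.2 <= p.2.
Hypothesis above_p : forall q, q \in flatten C -> q.2 = p.2 -> q.1 < p.1.

(** To break the link, [p] would have to lie in the row of [q] and weakly left of [r], hence in the
    column of [r] but above [r]. All members in the column of [p] are above [p]. *)
Let ext_link (O : pred pos) q r : (forall x, O x -> (x == p) || (x \in flatten C)) ->
  r \in flatten C -> link [in flatten C] q r -> link O q r.
Proof.
move=> sO rC lqr; apply: sub_link (lqr) => j hj /sO /predU1P[e|//].
have /linkP[e1 _ _] := lqr; have := left_p rC; rewrite -e /= => le.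
by have := above_p rC; rewrite -e /= => /(_ ltac:(lia)); lia.
Qed.

Let ext_chain (O : pred pos) c : (forall x, O x -> (x == p) || (x \in flatten C)) ->
  c \in C -> chain O c.
Proof.
move=> sO cC; case/andP: (chC) => _ /allP /(_ _ cC).
have: {subset c <= flatten C} by move=> x; apply: mem_chain.
case: c cC => //= q s _ sub /andP[-> /=].
elim: s q sub => //= r s IH q sub /andP[lqr ps].
rewrite ext_link ?IH // => [x xs|]; last by apply: sub; rewrite !inE eqxx orbT.
by apply: sub; rewrite inE xs orbT.
Qed.

Lemma chains_new : p.1 = 1 -> chains ([:: p] :: C).
Proof.
move=> p1; case/andP: (chC) => U _.
rewrite /chains /= pC U p1 /=; apply/allP=> c cC.
by apply: ext_chain.
Qed.

Lemma chains_extend s q : rcons s q \in C -> link [in flatten C] q p ->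
  chains (rcons (rcons s q) p :: rem (rcons s q) C).
Proof.
set c := rcons s q => cC lqp; have pf := perm_flatten (perm_to_rem cC).
have memE x : (x \in rcons c p ++ flatten (rem c C)) = (x == p) || (x \in flatten C).
  by rewrite (perm_mem pf) /= mem_cat mem_rcons inE mem_cat orbA.
have sO x : x \in flatten (rcons c p :: rem c C) -> (x == p) || (x \in flatten C).
  by rewrite memE.
apply/andP; split.
  rewrite /= cat_rcons -cat1s uniq_catCA /= -(perm_uniq pf) -(perm_mem pf) pC.
  by case/andP: chC.
apply/andP; split; last by apply/allP=> d /mem_rem dC; apply: ext_chain.
(* The new position cannot obstruct its own link, being one row below [q]. *)
have lqp' : link [in flatten (rcons c p :: rem c C)] q p.
  apply: sub_link (lqp) => j _; rewrite /= memE => /predU1P[e|//].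
  by move: lqp; rewrite -e => /linkP[/=]; lia.
have := ext_chain sO cC; rewrite /c in lqp' *.
case: (s) lqp' => [|r s'] /= lqp'; first by move=> /andP[-> _]; rewrite lqp'.
by move=> /andP[-> h]; rewrite rcons_path h last_rcons.
Qed.

End Extend.

(** * Both steps remove a chain *)

Definition decomp (T : table) (C : seq (seq pos)) : Prop :=
  chains C /\ forall p, T p = ((p \in flatten C)%:R)%R.

Lemma decomp_one T C p : decomp T C -> Defs.one T p = (p \in flatten C).
Proof. by case=> _ eT; rewrite /Defs.one eT; case: (_ \in _). Qed.

Lemma decomp_clear T C c g : decomp T C -> c \in C -> g =i c ->
  decomp (clear T g) (rem c C).
Proof.
move=> [chC eT] cC gc; split; first exact: chains_rem.
move=> p; rewrite /clear gc mem_flatten_rem // eT.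
by case: (p \in c); rewrite ?andbT ?andbF.
Qed.

Lemma exists_max_mem (T : eqType) (f : T -> nat) (s : seq T) (P : pred T) x :
  x \in s -> P x -> exists2 y, (y \in s) && P y & forall z, z \in s -> P z -> f z <= f y.
Proof.
elim: s x => // a s IH x; rewrite inE => xs Px.
case: (boolP (has P s)) => [/hasP[z zs Pz]|/hasPn no].
  have [y /andP[ys Py] h] := IH z zs Pz.
  case: (boolP (P a && (f y <= f a))) => [/andP[Pa le]|h'].
    exists a; first by rewrite inE eqxx.
    move=> w; rewrite inE => /predU1P[->//|ws Pw]; exact: leq_trans (h _ ws Pw) le.
  exists y; first by rewrite inE ys orbT.
  move=> w; rewrite inE => /predU1P[->|ws Pw]; last exact: h.
  by move=> Pa; move: h'; rewrite Pa /= -ltnNge => /ltnW.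
case/predU1P: xs => [e|/no]; last by rewrite Px.
exists a; first by rewrite inE eqxx -e.
by move=> w; rewrite inE => /predU1P[->//|/no/negbTE->].
Qed.

Lemma step2_chain T C g e : decomp T C -> step2 T g e ->
  g \in C /\ e = last (0, 0) g.
Proof.
move=> dT; have [chC _] := dT => -[k [s [[-> ->] Og kmax ps stop]]]; split=> //.
have kO : (1, k) \in flatten C by case/andP: Og; rewrite (decomp_one _ dT).
have [s1 [s2 cC]] := chain_of kO.
(* The n-th element of a chain lies in row n, so a 1 of the first row is the head of its chain. *)
have s10 : s1 = [::] by have := chain_row chC cC; case: (s1).
subst s1; rewrite (greedy_descent chC cC (s := s)) //.
- by move=> j; rewrite /= -(decomp_one _ dT); apply: kmax.
- by case/andP: Og => _ /allP Os; apply/allP=> p /Os; rewrite (decomp_one _ dT).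
by move=> j; rewrite /= -(decomp_one _ dT); apply: stop.
Qed.

Lemma step2_exists T C : decomp T C -> 0 < size C -> exists g e, step2 T g e.
Proof.
move=> dT; have [chC _] := dT; case: C dT chC => // c0 C0; set C := c0 :: C0 => dT chC _.
have [p pO p1] : exists2 p, p \in flatten C & p.1 = 1.
  have c0C : c0 \in C by rewrite inE eqxx.
  case/andP: (chC) => _ /allP /(_ _ c0C); case ec0: c0 c0C => [|p s] //= c0C /andP[/eqP p1 _].
  by exists p => //; apply: (mem_chain c0C); rewrite inE eqxx.
have [|[l k] /andP[kO /eqP /= l1] kmax] :=
  exists_max_mem (P := fun q : pos => q.1 == 1) snd pO.
  by rewrite p1.
subst l; have [s1 [s cC]] := chain_of kO.
have s10 : s1 = [::] by have := chain_row chC cC; case: (s1).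
subst s1; have rk : rightmost C (1, k) by move=> j Oj; apply: kmax Oj _.
exists ((1, k) :: s), (last (1, k) s), k, s; split=> //.
- by apply/allP=> q qc; rewrite (decomp_one _ dT); apply: mem_chain qc.
- by move=> j; rewrite (decomp_one _ dT); apply: rk.
- case/andP: (chC) => _ /allP /(_ _ cC) /andP[_]; apply: sub_path => q r.
  by case/linkP=> e le _; rewrite /down_right e eqxx.
move=> j; rewrite (decomp_one _ dT) => Oj; apply/negP=> le.
have rl := rightmost_last chC cC rk.
have lC : belast (1, k) s ++ [:: last (1, k) s] \in C by rewrite cats1 -lastI.
have /negP[] := last_childless chC lC Oj.
exact: rightmost_link.
Qed.

(** The choice made in Step 2' is exactly the source of a link, so by [link_inj] it is the
    predecessor in the chain. *)
Lemma climb_chain T C p s s1 s2 : decomp T C -> s1 ++ p :: s2 \in C ->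
  climb T p s -> s = rev s1.
Proof.
move=> dT; have [chC _] := dT => cC h; elim: h s1 s2 cC => {p s}.
  by move=> k s1 s2 cC; have := chain_row chC cC; case: s1 cC.
move=> l k k' s o le mx _ IH s1 s2 cC.
case/lastP: s1 cC => [|s1 q] cC; first by have := chain_row chC cC.
rewrite cat_rcons in cC; have lq := chain_link chC cC.
have qO : q \in flatten C by apply: (mem_chain cC); rewrite mem_cat inE eqxx orbT.
have eq : q = (l.+1, k').
  apply: (link_inj (O := [in flatten C]) qO _ lq); first by rewrite /= -(decomp_one _ dT).
  apply/linkP; split=> // j /andP[/= lt lej]; rewrite -(decomp_one _ dT).
  by apply/negP=> /mx /(_ lej); rewrite leqNgt lt.
by subst q; rewrite rev_rcons (IH _ _ cC).
Qed.

Lemma chain_climb T C p s1 s2 : decomp T C -> s1 ++ p :: s2 \in C -> climb T p (rev s1).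
Proof.
move=> dT; have [chC _] := dT; elim/last_ind: s1 p s2 => [|s1 q IH] [l k] s2 cC.
  by have /= -> := chain_row chC cC; constructor.
rewrite cat_rcons in cC; have /linkP[/= el le no] := chain_link chC cC.
have qO : q \in flatten C by apply: (mem_chain cC); rewrite mem_cat inE eqxx orbT.
have row := chain_row chC cC; have cl := IH _ _ cC; subst l.
rewrite rev_rcons; case: q row le no qO cl {IH cC} => l k' /= -> le no qO cl.
apply: climb_up cl => //; first by rewrite (decomp_one _ dT).
move=> j; rewrite (decomp_one _ dT) => Oj lej; rewrite leqNgt; apply/negP=> lt.
by have := no j; rewrite lt lej Oj => /(_ isT).
Qed.

Lemma lowest_last C s1 p s2 : chains C -> s1 ++ p :: s2 \in C ->
  (forall q, q \in flatten C -> q.1 <= p.1) -> s2 = [::].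
Proof.
case: s2 => // q s2 chC cC mx; have /linkP[e _ _] := chain_link chC cC.
have := mx q; rewrite e ltnn => /(_ (mem_chain cC _)) h.
by suff: false by []; apply: h; rewrite mem_cat !inE eqxx !orbT.
Qed.

Lemma step2'_chain T C g e : decomp T C -> step2' T g e ->
  exists2 c : seq pos, c \in C & g = rev c /\ e = last (0, 0) c.
Proof.
move=> dT; have [chC _] := dT => -[s [-> eO mx cl]].
rewrite (decomp_one _ dT) in eO; have [s1 [s2 cC]] := chain_of eO.
have s20 : s2 = [::].
  by apply: lowest_last cC _ => // q; rewrite -(decomp_one _ dT); apply: mx.
exists (s1 ++ e :: s2) => //; rewrite s20 cats1 last_rcons rev_rcons.
by rewrite (climb_chain dT cC cl).
Qed.

Lemma step2'_exists T C : decomp T C -> 0 < size C -> exists g e, step2' T g e.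
Proof.
move=> dT; have [chC _] := dT => C0.
have [p pO] : exists p, p \in flatten C.
  case: C C0 chC {dT} => // -[|p c] C _ /andP[_] //= _.
  by exists p; rewrite inE eqxx.
have [//|e /andP[eO _] mx] := exists_max_mem (P := xpredT) fst pO.
have [s1 [s2 cC]] := chain_of eO; exists (e :: rev s1), e, (rev s1); split=> //.
- by rewrite (decomp_one _ dT).
- by move=> q; rewrite (decomp_one _ dT) => /mx; apply.
exact: chain_climb cC.
Qed.

(** * Runs of a step that removes one chain at a time *)

Section Run.
Variables (st : step) (order : seq pos -> seq pos).
Hypothesis order_mem : forall c, order c =i c.
Hypothesis st_chain : forall T C g e, decomp T C -> st T g e ->
  exists2 c : seq pos, c \in C & g = order c /\ e = last (0, 0) c.
Hypothesis st_exists : forall T C, decomp T C -> 0 < size C -> exists g e, st T g e.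

(** [C1] collects the chains removed so far and [C2] those left. The map [order] is the identity for
    Step 2 and reversal for Step 2', which lists its group from the bottom. *)
Lemma run_chains T C gs T' : decomp T C -> run st T gs T' ->
  exists C1 C2 : seq (seq pos), [/\ perm_eq C (C1 ++ C2), decomp T' C2
    & gs = [seq (order c, last (0, 0) c) | c <- C1]].
Proof.
move=> dT r; elim: r C dT => {T gs T'} [T|T g e gs T' sT _ IH] C dT.
  by exists [::], C.
have [c cC [eg ee]] := st_chain dT sT; subst g e.
have [|C1 [C2 [pC dC2 ->]]] := IH (rem c C).
  exact: decomp_clear.
by exists (c :: C1), C2; split=> //; rewrite (permPl (perm_to_rem cC)) perm_cons.
Qed.

Lemma run_complete T C gs T' : decomp T C -> run st T gs T' -> size gs = size C ->
  (forall p, T' p = 0%R) /\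
  exists2 C1 : seq (seq pos), perm_eq C C1 & gs = [seq (order c, last (0, 0) c) | c <- C1].
Proof.
move=> dT /(run_chains dT)[C1 [C2 [pC [_ eT'] ->]]].
rewrite size_map (perm_size pC) size_cat -{1}[size C1]addn0 => /addnI/esym/size0nil C20.
by subst C2; split=> [p|]; [rewrite eT'|exists C1 => //; rewrite cats0 in pC].
Qed.

Lemma run_progress T C gs T' : decomp T C -> run st T gs T' -> size gs < size C ->
  exists g e, st T' g e.
Proof.
move=> dT /(run_chains dT)[C1 [C2 [pC dC2 ->]]].
rewrite size_map (perm_size pC) size_cat -{1}[size C1]addn0 ltn_add2l; exact: st_exists.
Qed.

End Run.

(** * Bit strings of the carriers *)

Section Counts.
Variable d : nat -> bool.
Definition ones n := \sum_(i < n) d i.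
Definition zeros n := \sum_(i < n) ~~ d i.

Lemma ones0 : ones 0 = 0. Proof. exact: big_ord0. Qed.
Lemma zeros0 : zeros 0 = 0. Proof. exact: big_ord0. Qed.
Lemma onesS n : ones n.+1 = ones n + d n. Proof. exact: big_ord_recr. Qed.
Lemma zerosS n : zeros n.+1 = zeros n + ~~ d n. Proof. exact: big_ord_recr. Qed.

Lemma zeros_ones n : zeros n + ones n = n.
Proof. by elim: n => [|n IH]; rewrite ?ones0 ?zeros0 // onesS zerosS; case: (d n) => /=; lia. Qed.

Lemma zeros_le m n : m <= n -> zeros m <= zeros n.
Proof.
move=> /subnK<-; elim: (n - m) => // k IH.
by rewrite addSn zerosS (leq_trans IH) ?leq_addr.
Qed.

Lemma ones_full n : ones n = n -> forall i, i < n -> d i.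
Proof.
elim: n => // n IH; rewrite onesS => e i; have := zeros_ones n.
case dn: (d n) e => /= e zo; last by lia.
by rewrite ltnS leq_eqVlt => /predU1P[->//|]; apply: IH; lia.
Qed.
End Counts.

(** The count up to [i.+1] includes bit [i] itself, so it is the rank of that bit among the
    zeros. *)
Definition written (y : elt) (d : nat -> bool) (i : nat) : bool :=
  ~~ d i && (zeros d i.+1 <= y.2).

Definition evolve (y : elt) (d : nat -> bool) : nat -> bool := fun i =>
  if d i then y.1 < ones d i.+1 else zeros d i.+1 <= y.2.

Lemma sum_written y d n : \sum_(i < n) written y d i = minn (zeros d n) y.2.
Proof.
elim: n => [|n IH]; first by rewrite big_ord0 zeros0 min0n.
rewrite big_ord_recr /= IH /written zerosS; case: (d n) => /=; first by rewrite !addn0.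
by case: leqP => /=; lia.
Qed.

(** Restricted to the first [n] bits, this is the combinatorial R for a carrier of capacity [n]: the
    two minima count the erased and the written bits. *)
Lemma ones_evolve y d n :
  ones (evolve y d) n + minn (ones d n) y.1 = ones d n + minn (zeros d n) y.2.
Proof.
elim: n => [|n IH]; first by rewrite !ones0 zeros0 !min0n.
have -> : ones (evolve y d) n.+1 = ones (evolve y d) n + evolve y d n by exact: onesS.
rewrite zerosS onesS {2}/evolve zerosS onesS; case: (d n) => /=.
  by case: (ltnP y.1) => /=; lia.
by case: (leqP _ y.2) => /=; lia.
Qed.

Section Evolution.
Variable y : nat -> elt.

Fixpoint state j : nat -> bool :=
  if j is j'.+1 then evolve (y j') (state j') else xpred0.

(* Bits are numbered from 0 and rows from 1: row i.+1 records the writes of bit i. *)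
Definition tab (p : pos) : bool :=
  if p is (i.+1, j.+1) then written (y j) (state j) i else false.

Definition fill m j := minn (zeros (state j) m) (y j).2.

(* The subtractions never truncate, as [zeros] and [ones] add up to m. *)
Definition slack m j :=
  minn m ((y j).1 + (y j).2) - fill m j - minn (ones (state j) m) (y j).1.

Definition slacks m j := \sum_(0 <= i < j) slack m i.

Lemma state_ones0 m : ones (state 0) m = 0.
Proof. by rewrite /ones big1. Qed.

(** By [ones_evolve] a factor changes the number of ones by its writes minus its erasures; summation
    over the factors gives the identity. It expresses vacancy numbers by slacks. *)
Lemma slacks_eq m n :
  \sum_(0 <= j < n) minn m ((y j).1 + (y j).2) + ones (state n) m =
  slacks m n + 2 * \sum_(0 <= j < n) fill m j.
Proof.
elim: n => [|n IH]; first by rewrite /slacks !big_geq // state_ones0.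
rewrite /slacks !big_nat_recr //= -/(slacks m n).
have := ones_evolve (y n) (state n) m; have := zeros_ones (state n) m.
by rewrite /slack -/(fill m n); have := erefl (fill m n); rewrite {2}/fill; lia.
Qed.

Lemma slacks_le m i j : i <= j -> slacks m i <= slacks m j.
Proof. by move=> le; rewrite /slacks [leqRHS](big_cat_nat _ le) //= leq_addr. Qed.

Lemma state_last_write i n : state n i ->
  exists j, [/\ j < n, written (y j) (state j) i
    & forall k, j < k <= n -> state k i].
Proof.
elim: n => //= n IH sn; case: (boolP (state n i)) => sni.
  have [j [lt w h]] := IH sni; exists j; split=> //; first lia.
  move=> k /andP[ltk]; rewrite leq_eqVlt => /predU1P[->//|ltn].
  by apply: h; rewrite ltk.
exists n; split=> //; last by move=> k hk; have -> : k = n.+1 by lia.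
by move: sn; rewrite /evolve /written (negbTE sni).
Qed.

(** Ones are erased from the lowest bit on, so a surviving one protects the one just after it. *)
Lemma erase_above i n : state n i -> state n.+1 i -> state n i.+1 -> state n.+1 i.+1.
Proof. by rewrite /= /evolve => -> lt s; rewrite s onesS s addn1 ltnW. Qed.

(* No slack from j on: bit i is not erased after column j, so the letters 1 are
   fewer than the ones up to bit i, and bit i.+1 is not written, so the letters 2
   do not exceed the zeros; in column j itself bit i is the last zero to be filled
   or bit i.+1 is erased. *)
Lemma open_row i n : state n i -> ~~ state n i.+1 ->
  exists j, [/\ j < n, written (y j) (state j) i,
    forall k, j < k <= n -> state k i,
    forall k, j < k <= n -> ~~ state k i.+1
    & slacks i.+1 n = slacks i.+1 j].
Proof.
move=> sn sn1; have [j [lt w h]] := state_last_write sn.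
(* Downward induction from [n]: as bit [i] survives, a one at bit [i.+1] would survive up to [n]. *)
have z k : j < k <= n -> ~~ state k i.+1.
  move=> /andP[ltk /subnK]; move: (n - k) => r; elim: r k ltk => [|r IH] k ltk e.
    by rewrite add0n in e; rewrite e.
  apply/negP=> sk; have /negP[] := IH k.+1 ltac:(lia) ltac:(lia).
  by apply: erase_above sk; apply: h; lia.
exists j; split=> //; rewrite /slacks (big_cat_nat (leq0n j) (ltnW lt)) /=.
have -> : \sum_(j <= k < n) slack i.+1 k = 0; last by rewrite addn0.
rewrite big_nat_cond big1 // => k; rewrite andbT => /andP[lejk ltkn].
have := h k.+1 ltac:(lia); have := z k.+1 ltac:(lia).
rewrite /= /evolve /slack /fill !zerosS !onesS.
have := zeros_ones (state k) i.
case: (ltnP j k) => ltjk.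
  have := h k ltac:(lia); have := z k ltac:(lia) => /negbTE-> -> /=; lia.
have e : k = j by lia.
subst k; move: w; rewrite /written zerosS => /andP[/negbTE-> /=].
case: (state j i.+1) => /=; lia.
Qed.

End Evolution.

(** * Energies, riggings and vacancy numbers in terms of bits *)

Lemma state_ext y y' n : (forall i, i < n -> y i = y' i) -> state y n = state y' n.
Proof. by elim: n => //= n IH h; rewrite h // IH // => i lt; apply: h; lia. Qed.

(** A single bit string serves all capacities: the carrier of capacity [l] counts the zeros and ones
    among its first [l] bits. *)
Lemma carrier_state b l j :
  carrier b l j = (zeros (state (nth (0, 0) b) j) l, ones (state (nth (0, 0) b) j) l).
Proof.
set y := nth (0, 0) b; elim: j => [|j IH] /=.
  by have := zeros_ones (state y 0) l; rewrite state_ones0 /= addn0 => ->.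
have := ones_evolve (y j) (state y j) l; have := zeros_ones (state y j) l.
have := zeros_ones (evolve (y j) (state y j)) l.
rewrite IH /combR /Q0 /Q1 -/y /=; set z := zeros (evolve _ _) _; set o := ones (evolve _ _) _.
by move=> *; congr (_, _); lia.
Qed.

Lemma locE_fill b l j : locE b l j.+1 = fill (nth (0, 0) b) l j.
Proof. by case: l => [|l]; rewrite /fill ?zeros0 ?min0n //= carrier_state. Qed.

Lemma locE_sum b l n :
  \sum_(1 <= j < n.+1) locE b l j = \sum_(0 <= j < n) fill (nth (0, 0) b) l j.
Proof. by rewrite big_add1; apply: eq_bigr => j _; rewrite locE_fill. Qed.

Lemma energy_tableE b p : energy_table b p = ((tab (nth (0, 0) b) p)%:R)%R.
Proof.
case: p => [[|i] [|j]] //=; rewrite /energy_table /=.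
case: ltnP => [_|le] //=.
  rewrite -[energyH _ _]/(locE b i.+1 j.+1) !locE_fill /fill -!sum_written big_ord_recr /=.
  by rewrite PoszD GRing.addrAC GRing.subrr GRing.add0r; case: written.
(* Beyond the path the default factor [(0, 0)] writes nothing. *)
by rewrite nth_default // /written zerosS; case: (state _ j i) => //=; rewrite addn1.
Qed.

Lemma tab_written y i j : tab y (i.+1, j.+1) = written (y j) (state y j) i.
Proof. by []. Qed.

(* The rigging created in column p.2, as the bits 1, ..., p.1 are then all one. *)
Definition rig (y : nat -> elt) (p : pos) : int :=
  ((slacks y p.1 p.2.-1)%:Z - p.1%:Z)%R.

Definition sizes (b : seq elt) : seq nat := [seq x.1 + x.2 | x <- b].

Lemma nth_sizes b k : nth 0 (sizes b) k = (nth (0, 0) b k).1 + (nth (0, 0) b k).2.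
Proof. by elim: b k => [|x b IH] [|k] //=. Qed.

Lemma rigging_rig b p : tab (nth (0, 0) b) p -> rigging (sizes b) b p = rig (nth (0, 0) b) p.
Proof.
case: p => [[|i] [|j]] //; set y := nth _ _; rewrite tab_written => w.
rewrite /rigging locE_fill locE_sum big_add1 big_nat_recr //= /rig.
have -> : \sum_(0 <= k < j) minn i.+1 (nth 0 (sizes b) k) =
          \sum_(0 <= k < j) minn i.+1 ((y k).1 + (y k).2).
  by apply: eq_bigr => k _; rewrite nth_sizes.
have := slacks_eq y i.+1 j; have := zeros_ones (state y j) i.+1.
(* Bit [i] is written, hence so are all zeros before it. The term for column [j] thus completes the
   count of ones to the row length [i.+1]. *)
have : fill y i.+1 j = zeros (state y j) i.+1.
  by case/andP: w => _ le; apply/minn_idPl.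
by rewrite -/y /=; lia.
Qed.

(** By [locE_sum] this is the identity between the box count of the first m columns of the
    configuration and the energy E_m of the first [n] factors. *)
Definition rows_fill (mu : seq nat) y n :=
  forall m, \sum_(k <- mu) minn m k = \sum_(0 <= j < n) fill y m j.
Definition rows_size (lam : seq nat) (y : nat -> elt) n :=
  forall m, \sum_(k <- lam) minn m k = \sum_(0 <= j < n) minn m ((y j).1 + (y j).2).

Lemma vacancy_slacks lam mu y n m : rows_size lam y n -> rows_fill mu y n ->
  vacancy lam mu m = ((slacks y m n)%:Z - (ones (state y n) m)%:Z)%R.
Proof.
rewrite /vacancy => -> ->; have := slacks_eq y m n.
by move: (\sum_(0 <= j < n) _) (\sum_(0 <= j < n) _) => a c; lia.
Qed.

Lemma ones_bound y n : exists K, forall m, ones (state y n) m <= K.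
Proof.
elim: n => [|n [K h]]; first by exists 0 => m; rewrite state_ones0.
exists (K + (y n).2) => m; have := h m; have := ones_evolve (y n) (state y n) m.
by rewrite /=; lia.
Qed.

(** The bit string is infinite, but each factor writes at most as many ones as it has letters 2. *)
Lemma exists_zero y n : exists i, ~~ state y n i.
Proof.
have [K h] := ones_bound y n.
case: (boolP (all (state y n) (iota 0 K.+1))) => [/allP a|/allPn[i _ ?]]; last by exists i.
have e : ones (state y n) K.+1 = K.+1.
  rewrite /ones (eq_bigr (fun=> 1)) ?sum1_card ?card_ord // => i _.
  by rewrite a // mem_iota add0n ltn_ord.
by have := h K.+1; rewrite e ltnn.
Qed.

Section FirstZero.
Variables (d : nat -> bool) (t l : nat).
Hypothesis before : forall i, i < l -> evolve (0, t) d i.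
Hypothesis at_l : ~~ evolve (0, t) d l.

Lemma evolve0 i : evolve (0, t) d i = d i || (zeros d i.+1 <= t).
Proof. by rewrite /evolve onesS; case: (d i) => //=; rewrite addn1. Qed.

(** The zeros of [d] before [l] have all been filled and the one at [l] has not, so [l] is the next
    zero to be written by one more letter 2. *)
Lemma first_zero : ~~ d l /\ zeros d l = t.
Proof.
move: at_l; rewrite evolve0 negb_or -ltnNge => /andP[dl]; rewrite dl zerosS dl addn1 ltnS => ge.
split=> //; apply/eqP; rewrite eqn_leq ge andbT.
suff: forall k, k <= l -> zeros d k <= t by apply.
elim=> [|k IH] lt; first by rewrite zeros0.
have := before lt; rewrite evolve0; case: (boolP (d k)) => [dk _|_ //].
by rewrite zerosS dk addn0 IH // ltnW.
Qed.

Lemma written_before i : written (0, t) d i -> i < l.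
Proof.
have [dl zl] := first_zero; case/andP => _ /= le; rewrite ltnNge; apply/negP=> lei.
by have := @zeros_le d l.+1 i.+1 lei; rewrite zerosS dl zl; lia.
Qed.

Lemma written_succ i : written (0, t.+1) d i = written (0, t) d i || (i == l).
Proof.
have [dl zl] := first_zero; rewrite /written.
case: (ltngtP i l) => [lt|gt|->] /=; last by rewrite dl zerosS dl zl addn1 leqnn orbT.
  by rewrite orbF; have := @zeros_le d i.+1 l lt; rewrite zl => le; rewrite le (leqW le).
rewrite orbF; case di: (d i) => //=.
have := @zeros_le d l.+1 i gt; rewrite !zerosS dl zl di; lia.
Qed.

Lemma minn_zeros_succ m : minn (zeros d m) t.+1 = minn (zeros d m) t + (l < m).
Proof.
have [dl zl] := first_zero.
case: (ltnP l m) => le; have := zeros_le d le; rewrite ?zerosS ?dl zl /=; lia.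
Qed.

End FirstZero.

(** The invariant of the map [phi]: each row of the configuration comes from a chain, with its
    length and rigging read off at the last position of that chain. *)
Definition rigged_by_chains (rc : seq rrow) y n := exists C : seq (seq pos),
  [/\ chains C, forall p, (p \in flatten C) = tab y p,
      rows_fill [seq (last (0, 0) c).1 | c <- C] y n
    & perm_eq rc [seq ((last (0, 0) c).1, rig y (last (0, 0) c)) | c <- C]].

Lemma rigged_by_chains_rows rc y n : rigged_by_chains rc y n -> rows_fill (map fst rc) y n.
Proof.
case=> C [_ _ h p] m; rewrite -h (perm_big _ (perm_map fst p)) /=.
by rewrite -map_comp.
Qed.

Lemma slacks_ext y y' m n : (forall i, i < n -> y i = y' i) -> slacks y m n = slacks y' m n.
Proof.
move=> h; apply: eq_big_nat => i /andP[_ lt]; rewrite /slack /fill h //.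
by rewrite (@state_ext y y') // => j ltj; apply: h; lia.
Qed.

Lemma sum_incr_nth (s : seq nat) a m :
  \sum_(k <- incr_nth s a) minn m k = \sum_(k <- s) minn m k + (nth 0 s a < m).
Proof.
elim: s a => [|x s IH] [|a]; rewrite /= ?big_cons ?big_nil.
- case: m => //= m; lia.
- elim: a => [|a IHa] /=; rewrite ?big_cons ?big_nil; first by case: m => //= m; lia.
  by lia.
- by case: ltnP => /=; lia.
by rewrite IH addnA.
Qed.

Lemma set_nth_perm (T : eqType) (x0 v : T) s a : a < size s ->
  perm_eq (set_nth x0 s a v) (v :: rem (nth x0 s a) s).
Proof.
move=> lt; set x := nth x0 s a; rewrite set_nthE lt -cat1s perm_catCA /= perm_cons.
rewrite -(perm_cons x); apply: perm_trans (perm_to_rem (mem_nth x0 lt)).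
rewrite -[X in perm_eq _ X](cat_take_drop a) (drop_nth x0 lt) -/x.
by rewrite -[x :: drop _ _]cat1s perm_sym perm_catCA.
Qed.

Lemma iter_incr_nth (s : seq nat) k :
  iter k (incr_nth^~ (size s)) s = if k is 0 then s else rcons s k.
Proof.
elim: k => //= k ->; case: k => [|k]; first by elim: s => //= x s ->.
by elim: s => //= x s ->.
Qed.

(** * Adding a letter 2 *)

Lemma add_letter2_new n lam rc : {in rc, forall x, ~~ singular lam rc x} ->
  (add_letter2 n (lam, rc)).2 =
  rcons rc (1, vacancy (incr_nth lam n) (incr_nth (map fst rc) (size rc)) 1).
Proof.
move=> none; have no : ~~ has (longest_singular lam rc) rc.
  by apply/hasPn => x /none; apply: contra => /andP[].
rewrite /add_letter2 (hasNfind no) nth_incr_nth eqxx nth_default ?size_map //.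
by rewrite set_nthE ltnn subnn cats1.
Qed.

Lemma add_letter2_longest n lam rc x : x \in rc -> longest_singular lam rc x ->
  exists2 a, nth 0 (map fst rc) a = x.1 &
    perm_eq (add_letter2 n (lam, rc)).2
      ((x.1.+1, vacancy (incr_nth lam n) (incr_nth (map fst rc) a) x.1.+1) :: rem x rc).
Proof.
move=> xrc lx; have hx : has (longest_singular lam rc) rc by apply/hasP; exists x.
set a := find (longest_singular lam rc) rc.
have lt : a < size rc by rewrite -has_find.
have zrc := mem_nth (0, 0%R) lt.
(* Two longest singular rows have the same length, hence the same vacancy number as rigging. *)
have za : nth (0, 0%R) rc a = x.
  have := nth_find (0, 0%R) hx; rewrite -/a; set z := nth _ rc a in zrc *.
  case/andP: lx => sx /allP mx /andP[sz /allP mz].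
  have e1 : z.1 = x.1.
    by apply/eqP; rewrite eqn_leq (implyP (mx _ zrc) sz) (implyP (mz _ xrc) sx).
  by rewrite [z]surjective_pairing [x]surjective_pairing (eqP sz) (eqP sx) e1.
have na : nth 0 (map fst rc) a = x.1 by rewrite (nth_map (0, 0%R)) // za.
exists a => //; rewrite /add_letter2 -/a nth_incr_nth eqxx na add1n -za.
exact: set_nth_perm.
Qed.

Lemma minn_succ m k : minn m k.+1 = minn m k + (k < m).
Proof. by case: ltnP; lia. Qed.

Lemma last_in_chain C c : chains C -> c \in C ->
  exists s p, [/\ c = rcons s p, last (0, 0) c = p & p \in flatten C].
Proof.
move=> chC cC; case/andP: chC => _ /allP /(_ _ cC).
case/lastP: c cC => // s p cC _; exists s, p; rewrite last_rcons; split=> //.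
by apply: (mem_chain cC); rewrite mem_rcons inE eqxx.
Qed.

Lemma tab_col y p n : (forall j, n <= j -> y j = (0, 0)) -> tab y p -> p.2 <= n.
Proof.
case: p => [[|i] [|j]] //= y0; rewrite ltnNge /written => w; apply/negP=> le.
by move: w; rewrite y0 // zerosS => /andP[-> /=]; rewrite addn1.
Qed.

Section Letter2.
Variables (y y' : nat -> elt) (n t : nat).
Hypothesis y'_before : forall i, i < n -> y' i = y i.
Hypotheses (y_n : y n = (0, t)) (y'_n : y' n = (0, t.+1)).
Hypotheses (y_after : forall i, n < i -> y i = (0, 0))
           (y'_after : forall i, n < i -> y' i = (0, 0)).

Let state_y' j : j <= n -> state y' j = state y j.
Proof. by move=> le; apply: state_ext => i lt; apply: y'_before; lia. Qed.

Variable l : nat.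
Hypothesis full_below : forall i, i < l -> state y n.+1 i.
Hypothesis zero_at : ~~ state y n.+1 l.

Let below i : i < l -> evolve (0, t) (state y n) i.
Proof. by rewrite -y_n; apply: full_below. Qed.
Let at_l : ~~ evolve (0, t) (state y n) l.
Proof. by rewrite -y_n. Qed.

(** Factor [n] is being read: [y] and [y'] hold it before and after its letter 2 number [t.+1], its
    letters 1 being still absent. That letter writes the first zero bit [l]. *)
Lemma tab_letter2 p : tab y' p = tab y p || (p == (l.+1, n.+1)).
Proof.
case: p => [[|i] [|j]]; rewrite xpair_eqE ?andbF // !eqSS /=.
case: (ltngtP j n) => [lt|gt|->].
- by rewrite andbF orbF state_y' ?y'_before // ltnW.
- rewrite andbF orbF y_after // y'_after // /written !zerosS.
  by case: (state y' j i) (state y j i) => -[] /=; rewrite ?addn1.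
by rewrite andbT (state_y' (leqnn n)) y'_n y_n (written_succ below at_l).
Qed.

Lemma rig_letter2 p : p.2 <= n.+1 -> rig y' p = rig y p.
Proof.
move=> le; rewrite /rig; congr (_ - _)%R; congr Posz; apply: slacks_ext => i lt.
by apply: y'_before; lia.
Qed.

Lemma fill_letter2 m :
  \sum_(0 <= j < n.+1) fill y' m j = \sum_(0 <= j < n.+1) fill y m j + (l < m).
Proof.
rewrite !big_nat_recr //= -addnA; congr (_ + _).
  by apply: eq_big_nat => j /andP[_ lt]; rewrite /fill state_y' ?y'_before // ltnW.
by rewrite /fill state_y' // y_n y'_n (minn_zeros_succ below at_l).
Qed.

Variables (lam : seq nat) (rc : seq rrow).
Hypotheses (lam_y : rows_size lam y n.+1) (lam_y' : rows_size (incr_nth lam n) y' n.+1).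

(** After the write the first [l.+1] bits are all one. Column [n] adds no slack there, as each of
    its [t.+1] letters fills one of these bits. *)
Lemma new_vacancy a : rows_fill (map fst rc) y n.+1 -> nth 0 (map fst rc) a = l ->
  vacancy (incr_nth lam n) (incr_nth (map fst rc) a) l.+1 = rig y' (l.+1, n.+1).
Proof.
move=> hmu al; have hmu' : rows_fill (incr_nth (map fst rc) a) y' n.+1.
  by move=> m; rewrite sum_incr_nth hmu al fill_letter2.
rewrite (vacancy_slacks _ lam_y' hmu') /rig /=.
have := ones_evolve (y' n) (state y' n) l.+1; have := zeros_ones (state y' n) l.+1.
rewrite /slacks big_nat_recr //= -/(slacks _ _ _) /slack /fill y'_n state_y' //=.
have [dl zl] := first_zero below at_l; rewrite zerosS dl zl /=; lia.
Qed.

(** Slacks never decrease, so singularity forces the bits up to the length of the row to be all one;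
    hence they all precede the first zero [l]. *)
Lemma singular_full c C : chains C -> (forall p, (p \in flatten C) = tab y p) ->
  rows_fill (map fst rc) y n.+1 -> c \in C ->
  let x := ((last (0, 0) c).1, rig y (last (0, 0) c)) in
  singular lam rc x -> x.1 <= l.
Proof.
move=> chC eC hmu cC; have [s [p [_ -> pO]]] := last_in_chain chC cC.
rewrite /singular (vacancy_slacks _ lam_y hmu) /=; rewrite eC in pO.
have le := tab_col (y_after : forall j, n.+1 <= j -> _) pO.
case: p pO le => [[|i] [|j]] //= _; rewrite ltnS /rig /= => le /eqP e.
have := @slacks_le y i.+1 j n.+1 (leqW le); have := zeros_ones (state y n.+1) i.+1.
move=> /= zo sl; have /ones_full full : ones (state y n.+1) i.+1 = i.+1 by rewrite /=; lia.
by rewrite ltnNge; apply/negP=> li; have := zero_at; rewrite full.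
Qed.

Lemma rigged_by_chains_letter2 : rigged_by_chains rc y n.+1 ->
  rigged_by_chains (add_letter2 n (lam, rc)).2 y' n.+1.
Proof.
move=> sh; have hmu := rigged_by_chains_rows sh; case: sh => C [chC eC hC prc].
set p := (l.+1, n.+1).
have pC : p \notin flatten C.
  by rewrite eC /p /= y_n; apply/negP=> /(written_before below at_l); rewrite ltnn.
have left_p q : q \in flatten C -> q.2 <= p.2.
  by rewrite eC; apply: tab_col y_after.
have above_p q : q \in flatten C -> q.2 = p.2 -> q.1 < p.1.
  rewrite eC; case: q => [[|i] [|j]] //= w [ej]; subst j.
  by rewrite y_n in w; apply: written_before below at_l _ w.
pose row c : rrow := ((last (0, 0) c).1, rig y (last (0, 0) c)).
pose row' c : rrow := ((last (0, 0) c).1, rig y' (last (0, 0) c)).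
have row_eq c : c \in C -> row' c = row c.
  move=> cC; have [s [q [_ e /left_p le]]] := last_in_chain chC cC.
  by rewrite /row' /row e rig_letter2.
have prc' : perm_eq rc [seq row' c | c <- C] by rewrite (iffLR (eq_in_map _ _ _) row_eq).
have sing_le x : x \in rc -> singular lam rc x -> x.1 <= l.
  rewrite (perm_mem prc) => /mapP[c cC ->]; exact: singular_full cC.
(* For [l = 0] no row is singular, as rows have positive length: a new chain starts in the first
   row. *)
case: (posnP l) => [l0|l_gt0].
  exists ([:: p] :: C); split.
  - by apply: chains_new => //; rewrite /p l0.
  - by move=> q; rewrite /= inE eC tab_letter2 orbC.
  - move=> m; rewrite /= big_cons hC fill_letter2 addnC /= l0.
    by congr (_ + _); case: m => //= m; lia.
  rewrite add_letter2_new; last first.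
    move=> x xrc; apply/negP=> /(sing_le _ xrc); rewrite l0 leqn0.
    move: xrc; rewrite (perm_mem prc) => /mapP[c cC -> /=].
    have [s [q [_ -> qO]]] := last_in_chain chC cC.
    by move: qO; rewrite eC; case: q => [[]].
  have := @new_vacancy (size rc) hmu; rewrite l0 nth_default ?size_map // => -> //.
  rewrite -cats1 perm_catC /= /p l0 perm_cons.
  exact: prc'.
have one_l : state y n.+1 l.-1 by apply: full_below; rewrite prednK.
have zero_l : ~~ state y n.+1 l.-1.+1 by rewrite prednK.
(* The row to lengthen belongs to the last write of the bit just before [l], made in column
   [j.+1]. *)
have [j [ltj wj keep skip]] := open_row one_l zero_l; rewrite prednK // => sl.
set q : pos := (l, j.+1).
have qO : q \in flatten C by rewrite eC /q -(prednK l_gt0).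
have [s [s2 cC]] := chain_of qO.
(* A successor of [q] would be a later or simultaneous write of bit [l], which has stayed zero since
   then. *)
have s20 : s2 = [::].
  case: s2 cC => // r s2 cC; have /linkP[er ler _] := chain_link chC cC.
  have : r \in flatten C by apply: (mem_chain cC); rewrite mem_cat !inE eqxx !orbT.
  move=> rO; have := left_p _ rO; move: rO; rewrite eC.
  case: r er ler {cC} => [i [|k]] //= -> lek; rewrite -{1}(prednK l_gt0) /= => wk ltk.
  have /negP[] := skip k.+1 (introT andP (conj lek ltk)).
  by move: wk; rewrite prednK //= /evolve /written => /andP[/negbTE->].
subst s2; rewrite cats1 in cC; set c := rcons s q in cC.
have lq : last (0, 0) c = q by rewrite last_rcons.
have full : ones (state y n.+1) l = l.
  rewrite /ones (eq_bigr (fun=> 1)) ?sum1_card ?card_ord // => i _.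
  by rewrite full_below.
have sing_q : singular lam rc (row c).
  by rewrite /singular (vacancy_slacks _ lam_y hmu) /row lq /= sl -/(state y n.+1) full.
have q_rc : row c \in rc by rewrite (perm_mem prc) map_f.
have long_q : longest_singular lam rc (row c).
  rewrite /longest_singular sing_q; apply/allP => x xrc; apply/implyP => /(sing_le _ xrc).
  by rewrite /row lq.
have [a al pa] := add_letter2_longest n q_rc long_q.
exists (rcons c p :: rem c C); split.
(* The bit before [l] has stayed one since column [j], so it is not written between [q] and [p]. *)
- apply: chains_extend => //; apply/linkP; split=> //=.
  move=> [|k] // /andP[ltk lek]; rewrite eC -(prednK l_gt0) /=.
  by rewrite negb_and negbK keep //; apply/andP; split; [exact: ltk|exact: ltnW].
- move=> r; rewrite /= mem_cat mem_rcons inE tab_letter2 -eC -orbA orbC.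
  by rewrite (perm_mem (perm_flatten (perm_to_rem cC))) mem_cat.
- move=> m; rewrite fill_letter2 -hC /= (perm_big _ (perm_map _ (perm_to_rem cC))) /=.
  by rewrite !big_cons lq last_rcons /= minn_succ addnAC.
apply: perm_trans pa _; rewrite /= last_rcons /= {1}/row lq /=.
rewrite new_vacancy //; last by rewrite al /row lq.
rewrite perm_cons -(perm_cons (row c)) -{2}(row_eq _ cC).
have rq : row c = (l, rig y q) by rewrite /row lq.
rewrite -rq; apply: (@perm_trans _ rc); first by rewrite perm_sym; exact: perm_to_rem q_rc.
exact: perm_trans prc' (perm_map row' (perm_to_rem cC)).
Qed.

End Letter2.

(** * Conclusion *)

Lemma written_ext y y' d i : y.2 = y'.2 -> written y d i = written y' d i.
Proof. by rewrite /written => ->. Qed.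

(** The letters 1 of factor [n] only affect the bits after it, whereas the writes, riggings and
    energies of the first [n.+1] columns depend on the bits before it. *)
Lemma rigged_by_chains_ext rc y y' n :
  (forall i, i < n -> y i = y' i) -> (forall i, n <= i -> (y i).2 = (y' i).2) ->
  (forall i, n < i -> y' i = (0, 0)) ->
  rigged_by_chains rc y n.+1 -> rigged_by_chains rc y' n.+1.
Proof.
move=> before after zero [C [chC eC hC prc]].
have st j : j <= n -> state y j = state y' j.
  by move=> le; apply: state_ext => i lt; apply: before; lia.
have snd_eq j : (y j).2 = (y' j).2 by case: (ltnP j n) => [/before->|/after].
have tab_eq p : tab y p = tab y' p.
  case: p => [[|i] [|j]] //=; rewrite (written_ext _ _ (snd_eq j)).
  case: (leqP j n) => [/st-> //|lt]; rewrite zero // /written !zerosS.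
  by case: (state y j i) (state y' j i) => -[] /=; rewrite ?addn1.
have rig_eq c : c \in C -> rig y (last (0, 0) c) = rig y' (last (0, 0) c).
  move=> cC; have [s [p [_ -> pO]]] := last_in_chain chC cC.
  rewrite eC tab_eq in pO; have := tab_col (zero : forall j, n.+1 <= j -> _) pO.
  rewrite /rig => le; congr (_ - _)%R; congr Posz; apply: slacks_ext => i lt.
  by apply: before; lia.
exists C; split=> //.
- by move=> p; rewrite eC tab_eq.
- move=> m; rewrite hC; apply: eq_big_nat => j /andP[_ lt].
  by rewrite /fill snd_eq st.
apply: (perm_trans prc).
rewrite (_ : map _ _ = [seq ((last (0, 0) c).1, rig y' (last (0, 0) c)) | c <- C]) //.
by apply/eq_in_map => c cC; rewrite rig_eq.
Qed.

Lemma rigged_by_chains_next rc y n :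
  (y n).2 = 0 -> rigged_by_chains rc y n -> rigged_by_chains rc y n.+1.
Proof.
move=> z [C [chC eC hC prc]]; exists C; split=> // m.
by rewrite hC big_nat_recr //= /fill z minn0 addn0.
Qed.

Lemma iter_add_letter1 i k st :
  iter k (add_letter1 i) st = (iter k (incr_nth^~ i) st.1, st.2).
Proof. by elim: k => [|k IH]; [case: st | rewrite iterS IH]. Qed.

Lemma add_letter2_quantum i st : (add_letter2 i st).1 = incr_nth st.1 i.
Proof. by case: st. Qed.

Lemma iter_add_letter2_quantum i k st :
  (iter k (add_letter2 i) st).1 = iter k (incr_nth^~ i) st.1.
Proof. by elim: k => //= k IH; rewrite add_letter2_quantum IH. Qed.

Lemma phi_rcons b x : phi (rcons b x) = add_elt (size b) x (phi b).
Proof.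
rewrite /phi size_rcons -addn1 iotaD foldl_cat /= add0n nth_rcons ltnn eqxx.
congr add_elt; have : forall i, i \in iota 0 (size b) -> i < size b.
  by move=> i; rewrite mem_iota.
elim: (iota 0 (size b)) ([::], [::]) => //= i s IH st lt.
rewrite nth_rcons lt ?inE ?eqxx // IH // => j js; apply: lt.
by rewrite inE js orbT.
Qed.

Lemma rows_size_iter b x k : x.1 + x.2 = k ->
  rows_size (iter k (incr_nth^~ (size b)) (sizes b)) (nth (0, 0) (rcons b x)) (size b).+1.
Proof.
move=> e m; have -> : size b = size (sizes b) by rewrite size_map.
rewrite iter_incr_nth big_nat_recr //= size_map nth_rcons ltnn eqxx e.
have -> : \sum_(0 <= i < size b)
      minn m ((nth (0, 0) (rcons b x) i).1 + (nth (0, 0) (rcons b x) i).2) =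
    \sum_(j <- sizes b) minn m j.
  rewrite big_map (big_nth (0, 0)); apply: eq_big_nat => i /andP[_ lt].
  by rewrite nth_rcons lt.
by case: k {e} => [|k]; rewrite ?minn0 ?addn0 // -cats1 big_cat big_seq1.
Qed.

Lemma nth_rcons_after b (x : elt) i : size b < i -> nth (0, 0) (rcons b x) i = (0, 0).
Proof. by move=> lt; rewrite nth_default // size_rcons. Qed.

(** Letters 2 are read first, so after [t] of them the unfinished factor is the element [(0, t)]. *)
Lemma rigged_by_chains_iter b t :
  (phi b).1 = sizes b -> rigged_by_chains (phi b).2 (nth (0, 0) b) (size b) ->
  rigged_by_chains (iter t (add_letter2 (size b)) (phi b)).2
    (nth (0, 0) (rcons b (0, t))) (size b).+1.
Proof.
move=> q sh; elim: t => [|t IH].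
  apply: (@rigged_by_chains_ext _ (nth (0, 0) b)) => [i lt|i le|i|].
  - by rewrite nth_rcons lt.
  - by rewrite nth_default // nth_rcons ltnNge le /=; case: eqP.
  - exact: nth_rcons_after.
  by apply: rigged_by_chains_next => //; rewrite nth_default.
have [l zl below] : exists2 l, ~~ state (nth (0, 0) (rcons b (0, t))) (size b).+1 l &
    forall i, i < l -> state (nth (0, 0) (rcons b (0, t))) (size b).+1 i.
  have [l zl mn] := ex_minnP (exists_zero (nth (0, 0) (rcons b (0, t))) (size b).+1).
  exists l => // i lt; apply/negPn/negP => /mn; lia.
rewrite iterS; case e: (iter _ _ _) IH => [lam rc] IH.
have el : lam = iter t (incr_nth^~ (size b)) (sizes b).
  by rewrite -q -iter_add_letter2_quantum e.
apply: (rigged_by_chains_letter2 (n := size b) (t := t) _ _ _ _ _ below zl _ _ IH).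
- by move=> i lt; rewrite !nth_rcons lt.
- by rewrite nth_rcons ltnn eqxx.
- by rewrite nth_rcons ltnn eqxx.
- exact: nth_rcons_after.
- exact: nth_rcons_after.
- by rewrite el; apply: rows_size_iter.
by rewrite el; apply: (@rows_size_iter b (0, t.+1) t.+1).
Qed.

Lemma phi_rigged_by_chains b : all (leq 1) (sizes b) ->
  (phi b).1 = sizes b /\ rigged_by_chains (phi b).2 (nth (0, 0) b) (size b).
Proof.
elim/last_ind: b => [_|b x IH].
  split=> //; exists [::]; split=> //; last by move=> m; rewrite /= big_nil big_geq.
  move=> p; apply/esym/negP => w; have := tab_col (n := 0) (fun j _ => nth_nil _ j) w.
  by case: p w => [[|i] [|j]].
rewrite /sizes map_rcons all_rcons => /andP[x_gt0 /IH[q sh]].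
rewrite phi_rcons /add_elt iter_add_letter1 iter_add_letter2_quantum q -iterD size_rcons; split.
  (* Positivity of the factor ensures that its row is really created in the quantum space. *)
  rewrite -[size b](size_map (fun x => x.1 + x.2)) iter_incr_nth.
  by case: (x.1 + x.2) x_gt0.
apply: rigged_by_chains_ext (rigged_by_chains_iter x.2 q sh) => [i lt|i le|i].
- by rewrite !nth_rcons lt.
- by rewrite !nth_rcons ltnNge le /=; case: eqP.
exact: nth_rcons_after.
Qed.

(** At m = 1 each chain contributes exactly one box, its last position having positive row index. *)
Lemma totE_size b (C : seq (seq pos)) : chains C ->
  rows_fill [seq (last (0, 0) c).1 | c <- C] (nth (0, 0) b) (size b) ->
  totE b 1 = size C.
Proof.
move=> chC hC; rewrite /totE locE_sum -hC big_map -sum1_size.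
rewrite big_seq [RHS]big_seq; apply: eq_bigr => c cC.
have [s [p [ec -> _]]] := last_in_chain chC cC.
have := chain_row (s1 := s) (s2 := [::]) (p := p) chC.
by rewrite cats1 -ec => /(_ cC) ->; rewrite minnC; case: (size s).
Qed.

Lemma is_path_sizes lam b : is_path lam b -> lam = sizes b.
Proof.
case/andP=> _; elim: lam b => [|k lam IH] [|x b] //= /andP[/eqP<- /IH->]. by [].
Qed.

Lemma computes_phi_of_chains st order b (C : seq (seq pos)) :
  (forall c, order c =i c) ->
  (forall T C g e, decomp T C -> st T g e ->
    exists2 c : seq pos, c \in C & g = order c /\ e = last (0, 0) c) ->
  (forall T C, decomp T C -> 0 < size C -> exists g e, st T g e) ->
  decomp (energy_table b) C -> totE b 1 = size C -> (phi b).1 = sizes b ->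
  perm_eq (phi b).2 [seq ((last (0, 0) c).1, rig (nth (0, 0) b) (last (0, 0) c)) | c <- C] ->
  computes_phi st (sizes b) b.
Proof.
move=> om sc se dC eN q prc; split=> gs T r; rewrite eN => sz.
  exact: run_progress om sc se _ _ _ _ dC r sz.
have [T0 [C1 pC ->]] := run_complete om sc dC r sz; split=> //; split=> //.
apply: (perm_trans prc); rewrite (permPl (perm_map _ pC)) /rigged_rows -map_comp.
rewrite (_ : map _ _ =
  [seq ((last (0, 0) c).1, rig (nth (0, 0) b) (last (0, 0) c)) | c <- C1]) //.
apply/eq_in_map => c cC1 /=; congr (_, _); apply: rigging_rig.
have cC : c \in C by rewrite (perm_mem pC).
have [chC _] := dC; have [s [p [_ -> pO]]] := last_in_chain chC cC.
have := decomp_one p dC; rewrite pO /Defs.one energy_tableE.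
by case: tab.
Qed.

Theorem theorem3p6 (lam : seq nat) (b : seq elt) (hb : is_path lam b) :
  [/\ forall p : pos, energy_table b p = 0%R \/ energy_table b p = 1%R,
      computes_phi step2 lam b,
      computes_phi step2' lam b
    & forall (gs gs' : seq (seq pos * pos)) (T T' : table),
        run step2 (energy_table b) gs T -> size gs = totE b 1 ->
        run step2' (energy_table b) gs' T' -> size gs' = totE b 1 ->
        perm_eq (groups gs') (groups gs)].
Proof.
have elam := is_path_sizes hb; case/andP: hb => lam_gt0 _; subst lam.
have [q [C [chC eC hC prc]]] := phi_rigged_by_chains lam_gt0.
have sC := totE_size chC hC.
have dC : decomp (energy_table b) C by split=> // p; rewrite energy_tableE eC.
have order2 T D g e : decomp T D -> step2 T g e ->
    exists2 c : seq pos, c \in D & g = id c /\ e = last (0, 0) c.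
  by move=> dD /(step2_chain dD)[gD eg]; exists g.
split.
- by move=> p; rewrite energy_tableE; case: tab; [right|left].
- exact: computes_phi_of_chains order2 step2_exists dC sC q prc.
- exact: computes_phi_of_chains (@mem_rev _) step2'_chain step2'_exists dC sC q prc.
(* Both complete runs list all chains of the same [C]; passing to finite sets forgets the
   reversal. *)
move=> gs gs' T T' r sz r' sz'; rewrite sC in sz sz'.
have [_ [C1 pC ->]] := run_complete (order := id) (fun=> frefl _) order2 dC r sz.
have [_ [C2 pC' ->]] := run_complete (@mem_rev _) step2'_chain dC r' sz'.
rewrite /groups -!map_comp.
rewrite (_ : map _ C2 = [seq [fset p in c]%fset | c <- C2]).
  by apply: perm_map; rewrite -(permPl pC').
by apply/eq_map => c /=; apply/fsetP => p; rewrite !inE mem_rev.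
Qed.
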